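(* Let $k$ be a subfield of $\mathbf{C}$, let $A$ be a locally finite graded set with an operation $[\cdot,\cdot]$ on $\bar A=A\cup\{0\}$ satisfying (S0)–(S3), let $*$ be the associated quasi-shuffle product and $ш$ the shuffle product on $\mathfrak{A}=k\langle A\rangle$. Then the linear map $\exp:\mathfrak{A}\to\mathfrak{A}$ is an isomorphism of $(\mathfrak{A},ш)$ onto $(\mathfrak{A},* )$ as graded $k$-algebras.
   Context: $A$ is a graded set, $A=\bigsqcup_{n\ge1}A_n$ with each $A_n$ (the elements of degree $n$) finite; elements of $A$ are called letters and $|a|$ is the degree of a letter $a$. $\mathfrak{A}=k\langle A\rangle$ is the $k$-vector space of noncommutative polynomials in the letters, with basis the words (monomials) in the letters, including the empty word $1$. Juxtaposition denotes concatenation. $\ell(w)$ is the number of letters of a word $w$; its degree $|w|$ is the sum of the degrees of its letters, and $\mathfrak{A}$ is graded by degree. Let $\bar A=A\cup\{0\}$ and let $[\cdot,\cdot]:\bar A\times\bar A\to\bar A$ be a function satisfying: (S0) $[a,0]=0$ for all $a\in\bar A$; (S1) $[a,b]=[b,a]$ for all $a,b\in\bar A$; (S2) $[[a,b],c]=[a,[b,c]]$ for all $a,b,c\in\bar A$; (S3) for all $a,b\in A$, either $[a,b]=0$ or $|[a,b]|=|a|+|b|$. The quasi-shuffle product $*$ is the $k$-bilinear operation on $\mathfrak{A}$ defined recursively on words by $1*w=w*1=w$ and $aw_1*bw_2=a(w_1*bw_2)+b(aw_1*w_2)+[a,b](w_1*w_2)$ for letters $a,b$ and words $w_1,w_2$.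 The shuffle product $ш$ is defined by the same recursion with the last term omitted: $aw_1\,ш\,bw_2=a(w_1\,ш\,bw_2)+b(aw_1\,ш\,w_2)$. For a nonempty finite sequence of letters define $[a]=a$ and $[a_1,a_2,\dots,a_m]=[a_1,[a_2,\dots,a_m]]\in\bar A$. A composition of $n\ge1$ is a sequence $I=(i_1,\dots,i_l)$ of positive integers with sum $n$; $\mathcal{C}(n)$ is the set of compositions of $n$. For a word $w=a_1\cdots a_n$ and $I=(i_1,\dots,i_l)\in\mathcal{C}(n)$, set $I[w]=[a_1,\dots,a_{i_1}][a_{i_1+1},\dots,a_{i_1+i_2}]\cdots[a_{i_1+\dots+i_{l-1}+1},\dots,a_n]\in\mathfrak{A}$ (which is $0$ if any bracket is $0$). The linear map $\exp:\mathfrak{A}\to\mathfrak{A}$ is defined by $\exp(1)=1$ and $\exp(w)=\sum_{(i_1,\dots,i_l)\in\mathcal{C}(\ell(w))}\frac{1}{i_1!\cdots i_l!}(i_1,\dots,i_l)[w]$ for nonempty words $w$. *)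

(* Defs.v *)
From HB Require Import structures.
From mathcomp Require Import all_boot all_order all_algebra.
From mathcomp Require Export finmap reals complex.
From mathcomp.multinomials Require Export monalg.

Set Implicit Arguments.
Unset Strict Implicit.
Unset Printing Implicit Defensive.

Import GRing.Theory.
Local Open Scope ring_scope.

(* Noncommutative polynomials in the letters A: the monoid algebra of the free
   monoid {fmonom A}, whose product is concatenation. *)
Notation ncpoly k A := {malg k[{fmonom A}]}.

Section Letters.
Variables (A : choiceType) (deg : A -> nat).

Definition locally_finite_graded : Prop :=
  (forall a, (0 < deg a)%N) /\
  (forall n, exists s : seq A, forall a, deg a = n -> a \in s).

(* The set A \cup {0} is rendered as option A, with None for 0. *)
Record bracket_axioms (br : option A -> option A -> option A) : Prop := {
  bracket0 : forall x, br x None = None;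
  bracketC : forall x y, br x y = br y x;
  bracketA : forall x y z, br (br x y) z = br x (br y z);
  bracket_deg : forall a b, br (Some a) (Some b) = None \/
    exists2 c, br (Some a) (Some b) = Some c & deg c = (deg a + deg b)%N
}.

Definition wdeg (w : seq A) : nat := (\sum_(a <- w) deg a)%N.

End Letters.

(* Compositions of n.+1: a composition of n with an extra part 1 in front, or
   one with its first part increased. *)
Fixpoint compositions (n : nat) : seq (seq nat) :=
  if n is n'.+1 then
    [seq 1%N :: c | c <- compositions n'] ++
    [seq (head 0%N c).+1 :: behead c | c <- compositions n' & c != [::]]
  else [:: [::]].

Lemma mem_compositions n (I : seq nat) :
  (I \in compositions n) = (0%N \notin I) && (sumn I == n).
Proof.
elim: n I => [|n IHn] I.
  by case: I => [|[|i] I] /=; rewrite ?inE ?andbF.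
rewrite [compositions _]/= mem_cat; case: I => [|[|i] I].
- by apply/negbTE; rewrite negb_or; apply/andP; split; apply/mapP => -[].
- by rewrite inE eqxx /=; apply/negbTE; rewrite negb_or;
    apply/andP; split; apply/mapP => -[].
- rewrite inE /= addSn eqSS.
  have -> : (i.+1 :: I \in [seq 1%N :: c | c <- compositions n]) =
            (i == 0%N) && (I \in compositions n).
    apply/mapP/andP => [[J JP [-> ->]] // | [/eqP -> IP]]; by exists I.
  have -> : (i.+1 :: I \in [seq (head 0%N c).+1 :: behead c |
              c <- compositions n & c != [::]]) = (i :: I \in compositions n).
    apply/mapP/idP => [[[|j J]]|IP]; rewrite ?mem_filter //=.
      by move=> JP [-> ->].
    by exists (i :: I) => //; rewrite mem_filter.
  by rewrite !IHn inE /=; case: i => [|i] //=; rewrite orbF.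
Qed.

Lemma uniq_compositions n : uniq (compositions n).
Proof.
elim: n => [|n IHn] //=; rewrite cat_uniq; apply/and3P; split.
- by rewrite map_inj_uniq // => I J [].
- apply/hasPn => c /mapP[[|i I]]; rewrite mem_filter //= => IP ->.
  apply/mapP => -[J _ /= [i0 _]].
  by move: IP; rewrite i0 mem_compositions inE eqxx.
- rewrite map_inj_in_uniq ?filter_uniq //.
  by case=> [|i I] [|j J]; rewrite !mem_filter //= => _ _ [-> ->].
Qed.

Section QuasiShuffle.
Variables (k : fieldType) (A : choiceType).
Variable br : option A -> option A -> option A.

Definition word (w : seq A) : ncpoly k A := << FMonom w >>.

Definition letter (x : option A) : ncpoly k A :=
  if x is Some a then word [:: a] else 0.

Fixpoint shuffle_words (u : seq A) : seq A -> ncpoly k A :=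
  if u is a :: u' then
    fix shuffle_u (v : seq A) : ncpoly k A :=
      if v is b :: v' then
        letter (Some a) * shuffle_words u' v + letter (Some b) * shuffle_u v'
      else word u
  else word.

Fixpoint qshuffle_words (u : seq A) : seq A -> ncpoly k A :=
  if u is a :: u' then
    fix qshuffle_u (v : seq A) : ncpoly k A :=
      if v is b :: v' then
        letter (Some a) * qshuffle_words u' v + letter (Some b) * qshuffle_u v'
        + letter (br (Some a) (Some b)) * qshuffle_words u' v'
      else word u
  else word.

Definition linear_ext (f : seq A -> ncpoly k A) (x : ncpoly k A) : ncpoly k A :=
  \sum_(u <- msupp x) x@_u *: f u.

Definition bilinear_ext (f : seq A -> seq A -> ncpoly k A) (x y : ncpoly k A) :
    ncpoly k A :=
  \sum_(u <- msupp x) \sum_(v <- msupp y) (x@_u * y@_v) *: f u v.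

Definition shuffle := bilinear_ext shuffle_words.

Definition qshuffle := bilinear_ext qshuffle_words.

(* [a_1, ..., a_m], for m > 0; the value on the empty sequence is irrelevant,
   since the parts of a composition are positive. *)
Fixpoint brackets (s : seq A) : option A :=
  match s with
  | [::] => None
  | [:: a] => Some a
  | a :: s' => br (Some a) (brackets s')
  end.

Definition comp_act (c : seq nat) (w : seq A) : ncpoly k A :=
  \prod_(s <- reshape c w) letter (brackets s).

(* For w = 1 the only composition is the empty one, which gives exp(1) = 1. *)
Definition qexp_word (w : seq A) : ncpoly k A :=
  \sum_(c <- compositions (size w)) (\prod_(i <- c) (i`!)%:R)^-1 *: comp_act c w.

Definition qexp := linear_ext qexp_word.

End QuasiShuffle.

Section GradedAlgebras.
Variables (k : fieldType) (A : choiceType) (deg : A -> nat).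
Local Notation V := (ncpoly k A).

Definition homogeneous (n : nat) (x : V) : Prop :=
  forall w : {fmonom A}, w \in msupp x -> wdeg deg w = n.

(* The operation mul makes the vector space V, graded by degree, an associative
   graded algebra with the empty word as unit. *)
Record graded_algebra (mul : V -> V -> V) : Prop := {
  galg_linearl : forall y, linear (mul^~ y);
  galg_linearr : forall x, linear (mul x);
  galg_mulA : associative mul;
  galg_mul1l : left_id (word k [::]) mul;
  galg_mul1r : right_id (word k [::]) mul;
  galg_deg1 : homogeneous 0 (word k [::]);
  galg_degM : forall m n x y, homogeneous m x -> homogeneous n y ->
    homogeneous (m + n) (mul x y)
}.

Record graded_algebra_iso (mul1 mul2 : V -> V -> V) (f : V -> V) : Prop := {
  gaiso_source : graded_algebra mul1;
  gaiso_target : graded_algebra mul2;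
  gaiso_linear : linear f;
  gaiso_unit : f (word k [::]) = word k [::];
  gaiso_mul : forall x y, f (mul1 x y) = mul2 (f x) (f y);
  gaiso_bij : bijective f;
  gaiso_deg : forall n x, homogeneous n x <-> homogeneous n (f x)
}.

End GradedAlgebras.

(* Main.v *)
(* Cutting a word after its first block gives
     exp w = sum_(m >= 1) 1/m! [first m letters of w] exp (rest of w).
   Deconcatenation is multiplicative for the shuffle product, and since the
   bracket is commutative and associative all C(i+j, i) shuffles of a prefix of
   u of length i with a prefix of v of length j have the same bracket.  Hence
   the first blocks of the words in exp (u sh v) contribute, with coefficient
   C(i+j, i)/(i+j)! = 1/(i! j!), exactly the terms which the quasi-shuffle
   recursion produces in exp u * exp v, by induction on the lengths of the
   remaining words.  Finally exp is the identity plus an operator that shortens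
   words, so it is bijective; and the shuffle product is the quasi-shuffle
   product for the zero bracket, so that one proof of associativity serves
   both. *)
From HB Require Import structures.
Require Import Defs.
From mathcomp Require Import all_boot all_order all_algebra.
From mathcomp Require Import zify.

Set Implicit Arguments.
Unset Strict Implicit.
Unset Printing Implicit Defensive.

Import GRing.Theory Num.Theory.
Local Open Scope ring_scope.

(** * Linear and bilinear maps determined by their values on words *)

Section LinearExtension.
Variables (k : fieldType) (A : choiceType).
Local Notation V := (ncpoly k A).
Implicit Types (f : seq A -> V) (x y : V) (u v w : seq A).

(** Words outside the support have coefficient 0, so polynomials with different supports can be
    summed over one common index set. *)
Lemma linear_extEw f x (d : {fset {fmonom A}}) : (msupp x `<=` d)%fset ->
  linear_ext f x = \sum_(u <- d) x@_u *: f u.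
Proof.
move=> sub_d; rewrite /linear_ext (big_fset_incl _ sub_d) //= => u _ u_notin.
by rewrite mcoeff_outdom ?scale0r.
Qed.

Lemma linear_ext_is_linear f : linear (linear_ext f).
Proof.
move=> c x y; pose d := (msupp x `|` msupp y `|` msupp (c *: x + y))%fset.
rewrite !(@linear_extEw f _ d) ?fsubsetUr //; last 2 first.
- by rewrite /d -fsetUA (fsubset_trans _ (fsubsetUr _ _)) ?fsubsetUl.
- by rewrite /d -fsetUA fsubsetUl.
rewrite scaler_sumr -big_split; apply: eq_bigr => u _ /=.
by rewrite mcoeffD mcoeffZ scalerDl scalerA.
Qed.

HB.instance Definition _ f :=
  GRing.isLinear.Build k V V *:%R (linear_ext f) (linear_ext_is_linear f).

Lemma eq_linear_ext f g : f =1 g -> linear_ext f =1 linear_ext g.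
Proof. by move=> eq_fg x; apply: eq_bigr => u _; rewrite eq_fg. Qed.

Lemma linear_ext_of_word f w : linear_ext f (word k w) = f w.
Proof.
by rewrite /linear_ext /word msuppU1 big_seq_fset1 mcoeffU1 eqxx scale1r.
Qed.

Lemma linear_ext_word x : linear_ext (@word k A) x = x.
Proof.
rewrite [RHS]monalgE; apply: eq_bigr => u _; apply/malgP => v.
by rewrite mcoeffZ !mcoeffU /= fmK mulrnAr mulr1.
Qed.

Lemma ncpoly_ind (P : V -> Prop) :
  P 0 -> (forall c x y, P x -> P y -> P (c *: x + y)) ->
  (forall w, P (word k w)) -> forall x, P x.
Proof.
move=> P0 PD Pw x; rewrite -[x]linear_ext_word.
by apply: (big_rec P) => // u y _; apply: PD.
Qed.

Lemma eq_linear_on_words (f g : {linear V -> V}) :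
  (forall w, f (word k w) = g (word k w)) -> f =1 g.
Proof.
move=> fg; elim/ncpoly_ind => [|c x y fx fy|//]; first by rewrite !raddf0.
by rewrite !linearP fx fy.
Qed.

(** Nesting linear extensions this way gives linearity in [x]; exchanging the sums, in
    [bilinear_extEr], gives linearity in [y]. *)
Lemma bilinear_extEl (h : seq A -> seq A -> V) x y :
  bilinear_ext h x y = linear_ext (fun u => linear_ext (h u) y) x.
Proof.
apply: eq_bigr => u _; rewrite scaler_sumr.
by apply: eq_bigr => v _; rewrite scalerA.
Qed.

Lemma bilinear_extEr (h : seq A -> seq A -> V) x y :
  bilinear_ext h x y = linear_ext (fun v => linear_ext (h^~ v) x) y.
Proof.
rewrite /bilinear_ext exchange_big; apply: eq_bigr => v _; rewrite scaler_sumr.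
by apply: eq_bigr => u _; rewrite scalerA mulrC.
Qed.

Lemma bilinear_ext_linearl (h : seq A -> seq A -> V) y :
  linear ((bilinear_ext h)^~ y).
Proof. by move=> c x x'; rewrite !bilinear_extEl linearP. Qed.

Lemma bilinear_ext_linearr (h : seq A -> seq A -> V) x :
  linear (bilinear_ext h x).
Proof. by move=> c y y'; rewrite !bilinear_extEr linearP. Qed.

Lemma bilinear_ext_words (h : seq A -> seq A -> V) u v :
  bilinear_ext h (word k u) (word k v) = h u v.
Proof. by rewrite bilinear_extEl !linear_ext_of_word. Qed.

Lemma bilinear_ext_morph (f : {linear V -> V}) (h g : seq A -> seq A -> V) :
  (forall u v, f (h u v) = bilinear_ext g (f (word k u)) (f (word k v))) ->
  forall x y, f (bilinear_ext h x y) = bilinear_ext g (f x) (f y).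
Proof.
move=> fM x y; elim/ncpoly_ind: x => [|c x x' IH IH'|u].
- by rewrite !bilinear_extEl !raddf0.
- rewrite bilinear_ext_linearl !linearP [RHS]bilinear_ext_linearl.
  by rewrite IH IH'.
elim/ncpoly_ind: y => [|c y y' IH IH'|v]; last by rewrite bilinear_ext_words.
- by rewrite !bilinear_extEr !raddf0.
- rewrite bilinear_ext_linearr !linearP [RHS]bilinear_ext_linearr.
  by rewrite IH IH'.
Qed.

Lemma word_nil : word k [::] = 1 :> V.
Proof. by congr << _ >>; apply/eqP; rewrite fmP fm1. Qed.

Lemma word_cat u v : word k (u ++ v) = word k u * word k v :> V.
Proof.
rewrite malgM_def fgmulUU mulr1; congr << _ *g _ >>.
by apply/eqP; rewrite fmP fmM.
Qed.

Lemma word_cons a w : word k (a :: w) = letter k (Some a) * word k w :> V.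
Proof. exact: (word_cat [:: a]). Qed.

(* The library gives {malg k[K]} only a left algebra structure, unless K is
   commutative. *)
Lemma malg_scalerAr (K : monomType) c (x y : {malg k[K]}) :
  x * (c *: y) = c *: (x * y).
Proof.
rewrite (malgMEw (fsubset_refl _) (msuppZ_le c y)) malgME scaler_sumr.
apply: eq_bigr => u _; rewrite scaler_sumr; apply: eq_bigr => v _.
apply/malgP => w.
by rewrite !(mcoeffU, mcoeffZ) mulrnAr mulrCA.
Qed.

End LinearExtension.

(** * Conditions on the support, and inversion of unitriangular maps *)

Section Support.
Variables (k : fieldType) (A : choiceType).
Local Notation V := (ncpoly k A).
Implicit Types (P Q : seq A -> Prop) (x y : V).

(** Serves both for bounds on the length of words and for homogeneity. *)
Definition supported P x := forall u : {fmonom A}, u \in msupp x -> P u.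

Lemma sub_supported P Q x :
  (forall u, P u -> Q u) -> supported P x -> supported Q x.
Proof. by move=> PQ Px u /Px /PQ. Qed.

Lemma supported0 P : supported P 0.
Proof. by move=> u; rewrite msupp0. Qed.

Lemma supportedD P x y : supported P x -> supported P y -> supported P (x + y).
Proof.
move=> Px Py u /(fsubsetP (msuppD_le _ _)); rewrite in_fsetU.
by case/orP => [/Px|/Py].
Qed.

Lemma supportedZ P c x : supported P x -> supported P (c *: x).
Proof. by move=> Px u /(fsubsetP (msuppZ_le _ _)) /Px. Qed.

Lemma supported_sum P (I : eqType) (r : seq I) (F : I -> V) :
  (forall i, i \in r -> supported P (F i)) -> supported P (\sum_(i <- r) F i).
Proof.
move=> PF; rewrite big_seq; apply: (big_ind (supported P)) => //.
- exact: supported0.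
- by move=> *; apply: supportedD.
Qed.

Lemma supported_word P u : P u -> supported P (word k u).
Proof. by move=> Pu v; rewrite msuppU1 in_fset1 => /eqP ->. Qed.

Lemma supported_linear_ext P Q (f : seq A -> V) x :
  (forall u, P u -> supported Q (f u)) -> supported P x ->
  supported Q (linear_ext f x).
Proof. by move=> PQ Px; apply: supported_sum => u /Px /PQ; apply: supportedZ. Qed.

Lemma supported_letter P Q (s : option A) x :
  (forall a u, s = Some a -> P u -> Q (a :: u)) -> supported P x ->
  supported Q (letter k s * x).
Proof.
case: s => [a|] PQ Px; last by rewrite mul0r; apply: supported0.
move=> w /msuppM_le[u [v []]]; rewrite msuppU1 in_fset1 => /eqP -> /Px Pv ->.
by rewrite fmM; apply: PQ.
Qed.

(* [id - f] is nilpotent on words of bounded length. *)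
Lemma unitriangular_bijective (f : {linear V -> V}) :
  (forall w, supported (fun u => (size u < size w)%N) (f (word k w) - word k w)) ->
  bijective f.
Proof.
move=> f_tri; pose g := linear_ext (fun w => f (word k w) - word k w).
have gE x : g x = f x - x.
  rewrite -[RHS]/((f \- idfun) x); apply: eq_linear_on_words => w.
  by rewrite [LHS]linear_ext_of_word.
have g_lower n x : supported (fun u => (size u < n.+1)%N) x ->
    supported (fun u => (size u < n)%N) (g x).
  apply: supported_linear_ext => u lt_un.
  by apply: sub_supported (f_tri u) => v lt_vu; apply: leq_trans lt_vu _.
have empty_supported x : supported (fun u => (size u < 0)%N) x -> x = 0.
  by move=> x0; apply/malgP => u; rewrite mcoeff0; case: msuppP => // /x0.
have bounded x : exists n, supported (fun u => (size u < n)%N) x.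
  exists (\max_(u <- msupp x) (size (u : {fmonom A}))).+1 => u ux.
  by rewrite ltnS (leq_bigmax_seq (F := fun u : {fmonom A} => size u)).
have f_inj : injective f.
  apply: raddf_inj => x; have [n] := bounded x.
  elim: n x => [|n IHn] x sx fx0; first exact: empty_supported.
  (* If [f x = 0] then [x = - g x], and [g] lowers the length bound. *)
  apply: IHn => //; have -> : x = (-1) *: g x.
    by rewrite gE fx0 sub0r scalerN scaleN1r opprK.
  by apply: supportedZ; apply: g_lower.
have f_surj y : exists x, f x == y.
  have [n] := bounded y; elim: n y => [|n IHn] y sy.
    by exists 0; rewrite raddf0 (empty_supported y).
  (* With [f x = - g y], the vector [x + y] is a preimage of [y], because [f y - g y = y]. *)
  have [x /eqP fx] := IHn ((-1) *: g y) (supportedZ (c := -1) (g_lower _ _ sy)).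
  by exists (x + y); rewrite raddfD /= fx scaleN1r gE opprB addrNK.
have fK y : f (xchoose (f_surj y)) = y by apply/eqP/(xchooseP (f_surj y)).
by exists (fun y => xchoose (f_surj y)) => // x; apply: f_inj; rewrite fK.
Qed.

End Support.

(** * Homogeneous polynomials and degree-preserving maps *)

Section Homogeneous.
Variables (k : fieldType) (A : choiceType) (deg : A -> nat).
Local Notation V := (ncpoly k A).
Local Notation wdeg := (wdeg deg).
Local Notation homogeneous := (@homogeneous k A deg).

Lemma wdeg_nil : wdeg [::] = 0%N.
Proof. exact: big_nil. Qed.

Lemma wdeg_cons a w : wdeg (a :: w) = (deg a + wdeg w)%N.
Proof. exact: big_cons. Qed.

Lemma homogeneousE n x :
  homogeneous n x = supported (fun u => wdeg u = n) x.
Proof. by []. Qed.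

Lemma homogeneous_word w : homogeneous (wdeg w) (word k w).
Proof. exact: (supported_word (P := fun u => wdeg u = _)). Qed.

Lemma homogeneous_letter m n (s : option A) x :
  (forall a, s = Some a -> (deg a + m)%N = n) -> homogeneous m x ->
  homogeneous n (letter k s * x).
Proof.
move=> deg_s; apply: (supported_letter (P := fun w => wdeg w = m)
                                       (Q := fun w => wdeg w = n)) => a u /deg_s.
by rewrite wdeg_cons => <- ->.
Qed.

(** Turns homogeneity into a fixed-point equation, see [homogeneous_partP]. *)
Definition homogeneous_part n : V -> V :=
  linear_ext (fun u => if wdeg u == n then word k u else 0).

HB.instance Definition _ n := GRing.Linear.on (homogeneous_part n).

Lemma homogeneous_partP n x : homogeneous n x <-> homogeneous_part n x = x.
Proof.
split=> [xn|<-].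
  rewrite -[RHS]linear_ext_word; apply: eq_big_seq => u /xn ->.
  by rewrite eqxx.
apply: (supported_linear_ext (P := fun=> True) (Q := fun w => wdeg w = n)) => //.
by move=> u _; case: eqP => [un|_]; [exact: supported_word|exact: supported0].
Qed.

Lemma homogeneous_part_neq m n x :
  homogeneous m x -> m != n -> homogeneous_part n x = 0.
Proof.
move=> xm neq_mn; rewrite /homogeneous_part /linear_ext big_seq.
rewrite big1 // => u /xm ->.
by rewrite (negPf neq_mn) scaler0.
Qed.

(** Since [f] preserves the degree of words, it commutes with the projections [homogeneous_part n];
    an injective map then reflects their fixed points as well as preserving them. *)
Lemma graded_injective (f : {linear V -> V}) :
  injective f -> (forall w, homogeneous (wdeg w) (f (word k w))) ->
  forall n x, homogeneous n x <-> homogeneous n (f x).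
Proof.
move=> f_inj f_deg n x.
have comm y : f (homogeneous_part n y) = homogeneous_part n (f y).
  rewrite -[LHS]/((f \o homogeneous_part n) y).
  rewrite -[RHS]/((homogeneous_part n \o f) y).
  apply: eq_linear_on_words => w; rewrite /= {1}/homogeneous_part.
  rewrite linear_ext_of_word.
  case: eqP => [<-|/eqP neq_wn]; first exact/esym/homogeneous_partP/f_deg.
  by rewrite raddf0 (homogeneous_part_neq (f_deg w)).
by rewrite !homogeneous_partP -comm; split=> [->|/f_inj].
Qed.

End Homogeneous.

(** * Iterated brackets: concatenation, symmetry, degree *)

Section Brackets.
Variables (A : choiceType) (deg : A -> nat).
Variable br : option A -> option A -> option A.
Hypothesis br_axioms : bracket_axioms deg br.
Implicit Types (s t : seq A).

Lemma brackets_cat s t : s != [::] -> t != [::] ->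
  brackets br (s ++ t) = br (brackets br s) (brackets br t).
Proof.
elim: s => [//|a s IHs] _; case: t IHs => [//|b t] IHs _.
case: s IHs => [//|c s] IHs.
by rewrite -[LHS]/(br (Some a) (brackets br ((c :: s) ++ b :: t))) IHs
           // -(bracketA br_axioms).
Qed.

(** Permutations are generated by exchanges of two adjacent blocks at the front, and [brackets_cat]
    reduces such an exchange to commutativity of [br]. *)
Lemma perm_brackets s t : perm_eq s t -> brackets br s = brackets br t.
Proof.
apply: catCA_perm_subst => s1 s2 s3.
(* Empty blocks are set aside: their bracket is the default [None], which is absorbing and not
   neutral, so [brackets_cat] excludes them. *)
case: s1 => [|a1 s1]; rewrite ?cat0s ?cats0 // !catA.
case: s2 => [|a2 s2]; rewrite ?cats0 //.
have swap : brackets br ((a1 :: s1) ++ a2 :: s2) =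
    brackets br ((a2 :: s2) ++ a1 :: s1).
  by rewrite !brackets_cat // (bracketC br_axioms).
case: s3 => [|a3 s3]; first by rewrite !cats0 swap.
by rewrite ![brackets br (_ ++ a3 :: s3)]brackets_cat // swap.
Qed.

(** By [bracket0] a nonzero bracket has a nonzero inner bracket, so additivity of the degree passes
    along the recursion. *)
Lemma brackets_deg s c : brackets br s = Some c -> deg c = wdeg deg s.
Proof.
elim: s c => [//|a [|b s] IHs] c.
  by case=> <-; rewrite /wdeg big_seq1.
rewrite -[brackets _ _]/(br (Some a) (brackets br (b :: s))).
case E: (brackets _ _) => [d|]; last by rewrite (bracket0 br_axioms).
rewrite wdeg_cons -(IHs _ E).
by case: (bracket_deg br_axioms a d) => [->//|[e -> <-] [->]].
Qed.

End Brackets.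

(** * Shuffles of two words, as a list *)

Section Shuffles.
Variable A : Type.
Implicit Types (u v w p q : seq A).

(** Lists the words of the shuffle product with multiplicity, so that any function of a word, in
    particular of its cuts, can be summed over them. *)
Fixpoint shuffles u : seq A -> seq (seq A) :=
  if u is a :: u' then
    fix shuffles_u v :=
      if v is b :: v' then
        [seq a :: w | w <- shuffles u' v] ++ [seq b :: w | w <- shuffles_u v']
      else [:: u]
  else fun v => [:: v].

Lemma shuffles_cons a b u v : shuffles (a :: u) (b :: v) =
  [seq a :: w | w <- shuffles u (b :: v)] ++
  [seq b :: w | w <- shuffles (a :: u) v].
Proof. by []. Qed.

Lemma shuffles0r u : shuffles u [::] = [:: u].
Proof. by case: u. Qed.

End Shuffles.

(** * Cutting the shuffles of two words into prefix and suffix *)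

Section Deconcatenation.
Variables (A : eqType) (M : nmodType).
Implicit Types (F : seq A -> seq A -> M) (u v w p q : seq A).

(* Deconcatenation is a morphism for the shuffle product; since F does not see
   the order of the letters of its first argument, the 'C(i + j, i) shuffles of
   the two prefixes all contribute equally. *)
Lemma sum_shuffles_take_drop F u v :
  (forall p p' q, perm_eq p p' -> F p q = F p' q) ->
  \sum_(w <- shuffles u v) \sum_(m < (size w).+1) F (take m w) (drop m w) =
  \sum_(i < (size u).+1) \sum_(j < (size v).+1)
     (\sum_(q <- shuffles (drop i u) (drop j v)) F (take i u ++ take j v) q)
       *+ 'C(i + j, i).
Proof.
elim: u v F => [|a u IHu] v F F_perm.
  rewrite big_seq1 big_ord1; apply: eq_bigr => m _.
  by rewrite /= big_seq1 bin0 mulr1n.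
elim: v F F_perm => [|b v IHv] F F_perm.
  rewrite big_seq1; apply: eq_bigr => m _.
  by rewrite big_ord1 drop0 take0 shuffles0r big_seq1 cats0 addn0 binn mulr1n.
have F_perm_cons c p p' q : perm_eq p p' -> F (c :: p) q = F (c :: p') q.
  by move=> pp'; apply: F_perm; rewrite perm_cons.
pose B i j := \sum_(q <- shuffles (drop i (a :: u)) (drop j (b :: v)))
                 F (take i (a :: u) ++ take j (b :: v)) q.
(* The prefix is empty, or starts with [a], or starts with [b]; the induction hypotheses treat what
   follows that letter, hence the shifts [i.+1] and [j.+1]. *)
have -> : \sum_(w <- shuffles (a :: u) (b :: v))
    \sum_(m < (size w).+1) F (take m w) (drop m w) =
  B 0%N 0%N
  + \sum_(i < (size u).+1) \sum_(j < (size v).+2) B i.+1 j *+ 'C(i + j, i)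
  + \sum_(i < (size u).+2) \sum_(j < (size v).+1) B i j.+1 *+ 'C(i + j, i).
  under eq_bigr => w _ do rewrite big_ord_recl take0 drop0.
  rewrite big_split -addrA; congr (_ + _).
  rewrite shuffles_cons big_cat !big_map /=.
  rewrite (IHu _ (fun p => F (a :: p))); last by move=> *; apply: F_perm_cons.
  rewrite (IHv (fun p => F (b :: p))); last by move=> *; apply: F_perm_cons.
  congr (_ + _); apply: eq_bigr => i _; apply: eq_bigr => j _.
  (* The leading [b] has to move behind the letters taken from [a :: u], which is a permutation of
     the prefix. *)
  congr (_ *+ _); apply: eq_bigr => q _; apply: F_perm.
  by rewrite /= -cat1s -[_ ++ b :: _]/(_ ++ [:: b] ++ _) perm_catCA.
under [in RHS]eq_bigr => i _ do under eq_bigr => j _ do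
  rewrite -[X in X *+ _]/(B i j).
(* Row [i = 0] and column [j = 0] have coefficient 1 and each comes from one sum only; every other
   entry gets a term from both sums, added by Pascal's rule [binS]. *)
rewrite -addrA [X in _ + X]addrC addrA.
rewrite [X in _ + X + _]big_ord_recl [RHS]big_ord_recl [X in _ = X + _]big_ord_recl.
rewrite bin0 mulr1n !addrA -addrA; congr (_ + _ + _).
  by apply: eq_bigr => j _; rewrite !bin0.
rewrite -big_split; apply: eq_bigr => i _ /=.
rewrite addrC big_ord_recl [RHS]big_ord_recl /= !addn0 !binn -addrA; congr (_ + _).
rewrite -big_split; apply: eq_bigr => j _ /=.
by rewrite addrC -mulrnDr /bump /= !add1n !addnS !addSn -binS.
Qed.

End Deconcatenation.

(** * Products obeying the quasi-shuffle recursion on an abstract module *)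

(* [pre s] stands for left concatenation by the letter [s]. *)
Section LetterModule.
Variables (k : fieldType) (A : choiceType) (deg : A -> nat).
Variable br : option A -> option A -> option A.
Hypothesis br_axioms : bracket_axioms deg br.
Variables (M : lmodType k) (pre : option A -> {linear M -> M}).
Variables (mul : M -> M -> M) (one : M).
Hypothesis preN : forall x, pre None x = 0.
Hypothesis mul_linearl : forall y, linear (mul^~ y).
Hypothesis mul_linearr : forall x, linear (mul x).
Local Notation "x ** y" := (mul x y) (at level 40, left associativity).
Implicit Types (x y z : M) (r s t : option A) (u v w : seq A).

Let zero_mul y : 0 ** y = 0.
Proof. by have:= mul_linearl y (-1) 0 0; rewrite /= scaler0 addr0 scaleN1r addNr. Qed.

Let mul_zero x : x ** 0 = 0.
Proof. by have:= mul_linearr x (-1) 0 0; rewrite /= scaler0 addr0 scaleN1r addNr. Qed.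

Let mulDl x x' y : (x + x') ** y = x ** y + x' ** y.
Proof. by have:= mul_linearl y 1 x x'; rewrite /= !scale1r. Qed.

Let mulDr x y y' : x ** (y + y') = x ** y + x ** y'.
Proof. by have:= mul_linearr x 1 y y'; rewrite /= !scale1r. Qed.

Let mulZl c x y : (c *: x) ** y = c *: (x ** y).
Proof. by have:= mul_linearl y c x 0; rewrite /= zero_mul !addr0. Qed.

Let mulZr c x y : x ** (c *: y) = c *: (x ** y).
Proof. by have:= mul_linearr x c y 0; rewrite /= mul_zero !addr0. Qed.

Let mul_suml (I : Type) (r : seq I) (F : I -> M) y :
  (\sum_(i <- r) F i) ** y = \sum_(i <- r) F i ** y.
Proof. exact: (big_morph (mul^~ y) (fun x x' => mulDl x x' y) (zero_mul y)). Qed.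

Let mul_sumr (I : Type) (r : seq I) (F : I -> M) x :
  x ** (\sum_(i <- r) F i) = \sum_(i <- r) x ** F i.
Proof. exact: (big_morph (mul x) (mulDr x) (mul_zero x)). Qed.

(** The quasi-shuffle recursion, stated for arbitrary vectors and possibly zero letters, so that an
    iterated bracket may serve as first letter. *)
Definition letter_rule s t x y :=
  pre s x ** pre t y =
  pre s (x ** pre t y) + pre t (pre s x ** y) + pre (br s t) (x ** y).

Lemma letter_rule_None s t x y :
  s = None \/ t = None -> letter_rule s t x y.
Proof.
rewrite /letter_rule; case=> ->.
  by rewrite (bracketC br_axioms) (bracket0 br_axioms) !preN !zero_mul raddf0 !addr0.
by rewrite (bracket0 br_axioms) !preN !mul_zero raddf0 !addr0.
Qed.

Lemma letter_rule0l s t y : letter_rule s t 0 y.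
Proof. by rewrite /letter_rule raddf0 !zero_mul !raddf0 !addr0. Qed.

Lemma letter_rule0r s t x : letter_rule s t x 0.
Proof. by rewrite /letter_rule raddf0 !mul_zero !raddf0 !addr0. Qed.

Lemma letter_rule_linearl s t c x x' y :
  letter_rule s t x y -> letter_rule s t x' y -> letter_rule s t (c *: x + x') y.
Proof.
rewrite /letter_rule linearP /= !mulDl !mulZl !linearP /= => -> ->.
by rewrite !scalerDr [RHS](AC (2*2*2) (1*3*5*(2*4*6))).
Qed.

Lemma letter_rule_linearr s t c x y y' :
  letter_rule s t x y -> letter_rule s t x y' -> letter_rule s t x (c *: y + y').
Proof.
rewrite /letter_rule linearP /= !mulDr !mulZr !linearP /= => -> ->.
by rewrite !scalerDr [RHS](AC (2*2*2) (1*3*5*(2*4*6))).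
Qed.

Hypothesis mul_pre : forall s t x y, letter_rule s t x y.

(** The terms are sorted by which of the three factors feed the first letter: one, two or all three.
    [mul_pre3r] sorts the other bracketing alike. *)
Lemma mul_pre3l r s t x y z : (pre r x ** pre s y) ** pre t z =
  pre r ((x ** pre s y) ** pre t z) + pre s ((pre r x ** y) ** pre t z)
  + pre t ((pre r x ** pre s y) ** z)
  + (pre (br r s) ((x ** y) ** pre t z) + pre (br r t) ((x ** pre s y) ** z)
     + pre (br s t) ((pre r x ** y) ** z))
  + pre (br (br r s) t) ((x ** y) ** z).
Proof.
rewrite mul_pre !mulDl !mul_pre !raddfD /=.
by rewrite [LHS](AC (3*3*3) (1*4*(2*5*8)*(7*3*6)*9)).
Qed.

Lemma mul_pre3r r s t x y z : pre r x ** (pre s y ** pre t z) =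
  pre r (x ** (pre s y ** pre t z)) + pre s (pre r x ** (y ** pre t z))
  + pre t (pre r x ** (pre s y ** z))
  + (pre (br r s) (x ** (y ** pre t z)) + pre (br r t) (x ** (pre s y ** z))
     + pre (br s t) (pre r x ** (y ** z)))
  + pre (br r (br s t)) (x ** (y ** z)).
Proof.
rewrite mul_pre !mulDr !mul_pre !raddfD /=.
by rewrite [LHS](AC (3*3*3) (1*4*7*2*5*(3*6*8)*9)).
Qed.

Hypothesis one_mul : left_id one mul.
Hypothesis mul_one : right_id one mul.

(** Induction on the total length: the two triple expansions match term by term, the first letters
    of the last terms agreeing by associativity of [br]. *)
Lemma mul_words_assoc (word : seq A -> M) u v w :
  word [::] = one -> (forall a u, word (a :: u) = pre (Some a) (word u)) ->
  (word u ** word v) ** word w = word u ** (word v ** word w).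
Proof.
move=> word0 wordS; have [n] := ubnP (size u + size v + size w)%N.
elim: n u v w => // n IHn u v w; rewrite ltnS.
case: u => [|a u]; first by rewrite word0 !one_mul.
case: v => [|b v]; first by rewrite word0 mul_one one_mul.
case: w => [|c w]; first by rewrite word0 !mul_one.
move=> lt_n; rewrite !wordS mul_pre3l mul_pre3r (bracketA br_axioms) -!wordS.
by rewrite !IHn //; apply: leq_trans lt_n; rewrite /= ?addnS ?addSn ?ltnS
   ?leqW ?leqnSn.
Qed.

Hypothesis natr_neq0 : forall n, (0 < n)%N -> n%:R != 0 :> k.

Lemma exp_shuffle (E : seq A -> M) u v :
  E [::] = one ->
  (forall a w, E (a :: w) = \sum_(m < (size w).+2)
     (m`!%:R)^-1 *: pre (brackets br (take m (a :: w))) (E (drop m (a :: w)))) ->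
  \sum_(w <- shuffles u v) E w = E u ** E v.
Proof.
move=> E0 ES; have [n] := ubnP (size u + size v)%N.
elim: n u v => // n IHn u v; rewrite ltnS.
case: u => [|a u]; first by rewrite E0 one_mul big_seq1.
case: v => [|b v]; first by rewrite E0 mul_one shuffles0r big_seq1.
move=> lt_n.
(* The factorial is read off [size p], so [F] is invariant under permutations of [p]. *)
pose F p q := (((size p)`!)%:R)^-1 *: pre (brackets br p) (E q).
pose S := \sum_(w <- shuffles (a :: u) (b :: v)) \sum_(m < (size w).+1)
  F (take m w) (drop m w).
have ->: \sum_(w <- shuffles (a :: u) (b :: v)) E w = S.
  rewrite /S shuffles_cons !big_cat !big_map /=.
  by congr (_ + _); apply: eq_bigr => w _; rewrite ES; apply: eq_bigr => m _;
    rewrite /F size_take_min; congr ((_`!%:R)^-1 *: _); apply/esym/minn_idPl;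
    rewrite -ltnS.
rewrite {}/S sum_shuffles_take_drop; last first.
  by move=> p p' q pp'; rewrite /F (perm_size pp') (perm_brackets br_axioms pp').
pose G i j := ((i`!)%:R^-1 * (j`!)%:R^-1) *:
  pre (brackets br (take i (a :: u) ++ take j (b :: v)))
      (E (drop i (a :: u)) ** E (drop j (b :: v))).
transitivity (\sum_(i < (size u).+2) \sum_(j < (size v).+2) G i j).
  apply: eq_bigr => i _; apply: eq_bigr => j _.
  have le_iu : (i <= size (a :: u))%N by rewrite -ltnS.
  have le_jv : (j <= size (b :: v))%N by rewrite -ltnS.
  have [/andP[/eqP-> /eqP->]|ij_neq0] :=
    boolP ((i == 0%N :> nat) && (j == 0%N :> nat)).
    by rewrite /G big1 => [|q _]; rewrite /F preN scaler0 ?mul0rn.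
  rewrite /F -scaler_sumr -raddf_sum IHn; last first.
    by rewrite !size_drop; move: lt_n ij_neq0 le_iu le_jv => /=; lia.
  rewrite scalerMnl /G size_cat !size_takel //; congr (_ *: _).
  (* The binomial coefficient cancels against [(i + j)!]; it is invertible by [natr_neq0]. *)
  rewrite -mulr_natl -(bin_fact (leq_addr j i)) addKn !natrM !invfM mulVKf //.
  by rewrite natr_neq0 // bin_gt0 leq_addr.
have EuE : E (a :: u) = \sum_(i < (size u).+1)
    (i.+1`!)%:R^-1 *: pre (brackets br (a :: take i u)) (E (drop i u)).
  by rewrite ES big_ord_recl preN scaler0 add0r.
have EvE : E (b :: v) = \sum_(j < (size v).+1)
    (j.+1`!)%:R^-1 *: pre (brackets br (b :: take j v)) (E (drop j v)).
  by rewrite ES big_ord_recl preN scaler0 add0r.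
rewrite big_ord_recl [X in X + _]big_ord_recl.
have -> : G (ord0 : 'I_(size u).+2) (ord0 : 'I_(size v).+2) = 0.
  by rewrite /G preN scaler0.
rewrite add0r; under [X in _ + X]eq_bigr => i _ do rewrite big_ord_recl.
rewrite big_split /=.
have -> : \sum_(j < (size v).+1) G 0%N j.+1 = \sum_(j < (size v).+1)
   (j.+1`!)%:R^-1 *: pre (brackets br (b :: take j v)) (E (a :: u) ** E (drop j v)).
  by apply: eq_bigr => j _; rewrite /G fact0 invr1 mul1r.
have -> : \sum_(i < (size u).+1) G i.+1 0%N = \sum_(i < (size u).+1)
   (i.+1`!)%:R^-1 *: pre (brackets br (a :: take i u)) (E (drop i u) ** E (b :: v)).
  by apply: eq_bigr => i _; rewrite /G fact0 invr1 mulr1 cats0.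
pose x i := brackets br (a :: take i u).
pose y j := brackets br (b :: take j v).
pose X i := ((i.+1)`!)%:R^-1 *: pre (x i) (E (drop i u)).
pose Y j := ((j.+1)`!)%:R^-1 *: pre (y j) (E (drop j v)).
(* In the product of two first-block terms, the block of [v] comes first, or that of [u], or both
   merge; the merged term is [G i.+1 j.+1]. *)
have XY i j : X i ** Y j =
    ((j.+1)`!)%:R^-1 *: pre (y j) (X i ** E (drop j v)) +
    (((i.+1)`!)%:R^-1 *: pre (x i) (E (drop i u) ** Y j) + G i.+1 j.+1).
  rewrite /X /Y mulZl mulZr mul_pre !scalerDr /= !mulZl !mulZr !linearZ /=.
  rewrite !scalerA addrCA addrA [_ / (i.+1`!)%:R]mulrC; congr (_ + _ *: pre _ _).
  by rewrite /x /y -(brackets_cat br_axioms).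
rewrite {2}EuE mul_suml -/(X _).
under [in RHS]eq_bigr => i _.
  rewrite EvE mul_sumr; under eq_bigr => j _ do rewrite (XY i j).
  rewrite big_split big_split /=; over.
rewrite big_split [X in _ = X + _]exchange_big big_split.
(* Summing [X i] over [i] rebuilds [E (a :: u)], and summing [Y j] over [j] rebuilds [E (b :: v)]:
   these are the terms of [G] with one zero index. *)
congr (_ + (_ + _)).
- by apply: eq_bigr => j _; rewrite -scaler_sumr -raddf_sum -mul_suml -EuE.
- by apply: eq_bigr => i _; rewrite -scaler_sumr -raddf_sum -mul_sumr -EvE.
Qed.

End LetterModule.

(** * The quasi-shuffle algebra, and the exponential on words *)

Section QuasiShuffleAlgebra.
Variables (k : fieldType) (A : choiceType) (deg : A -> nat).
Variable br : option A -> option A -> option A.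
Hypothesis br_axioms : bracket_axioms deg br.
Local Notation V := (ncpoly k A).
Local Notation qw := (@qshuffle_words k A br).
Local Notation mul := (@qshuffle k A br).
Implicit Types (x y z : V) (u v w : seq A) (s t : option A).

Definition cons_letter s : V -> V := *%R (letter k s).

Lemma cons_letter_is_linear s : linear (cons_letter s).
Proof. by move=> c x y; rewrite /cons_letter mulrDr malg_scalerAr. Qed.

HB.instance Definition _ s :=
  GRing.isLinear.Build k V V *:%R (cons_letter s) (cons_letter_is_linear s).

Lemma cons_letterN x : cons_letter None x = 0.
Proof. exact: mul0r. Qed.

Lemma cons_letter_word a w : cons_letter (Some a) (word k w) = word k (a :: w).
Proof. exact/esym/word_cons. Qed.

Lemma qshuffle_linearl y : linear (mul^~ y).
Proof. exact: bilinear_ext_linearl. Qed.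

Lemma qshuffle_linearr x : linear (mul x).
Proof. exact: bilinear_ext_linearr. Qed.

Lemma qshuffle_wordE u v : mul (word k u) (word k v) = qw u v.
Proof. exact: bilinear_ext_words. Qed.

(** On words and nonzero letters this is the defining recursion; bilinearity and the vanishing of
    [None] give the rest. *)
Lemma qshuffle_letter_rule s t x y : letter_rule br cons_letter mul s t x y.
Proof.
case: s => [a|]; last by apply: (letter_rule_None br_axioms cons_letterN
  qshuffle_linearl qshuffle_linearr); left.
case: t => [b|]; last by apply: (letter_rule_None br_axioms cons_letterN
  qshuffle_linearl qshuffle_linearr); right.
elim/ncpoly_ind: x => [|c x x' IH IH'|u].
- exact: (letter_rule0l _ _ qshuffle_linearl).
- exact: (letter_rule_linearl qshuffle_linearl _ IH IH').
elim/ncpoly_ind: y => [|c y y' IH IH'|v].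
- exact: (letter_rule0r _ _ qshuffle_linearr).
- exact: (letter_rule_linearr qshuffle_linearr _ IH IH').
by rewrite /letter_rule /= !cons_letter_word !qshuffle_wordE.
Qed.

Lemma qshuffle1l : left_id (word k [::]) mul.
Proof.
by move=> x; rewrite /qshuffle bilinear_extEl linear_ext_of_word linear_ext_word.
Qed.

Lemma qshuffle1r : right_id (word k [::]) mul.
Proof.
move=> x; rewrite /qshuffle bilinear_extEr linear_ext_of_word.
by rewrite -[RHS]linear_ext_word; apply: eq_linear_ext => -[].
Qed.

Lemma qshufflePl c x x' y : mul (c *: x + x') y = c *: mul x y + mul x' y.
Proof. exact: qshuffle_linearl. Qed.

Lemma qshufflePr c x y y' : mul x (c *: y + y') = c *: mul x y + mul x y'.
Proof. exact: qshuffle_linearr. Qed.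

Lemma qshuffle0l y : mul 0 y = 0.
Proof. by rewrite /qshuffle bilinear_extEl raddf0. Qed.

Lemma qshuffle0r x : mul x 0 = 0.
Proof. by rewrite /qshuffle bilinear_extEr raddf0. Qed.

Lemma qshuffleA : associative mul.
Proof.
move=> x y z.
elim/ncpoly_ind: x => [|c x x' IH IH'|u].
- by rewrite !qshuffle0l.
- by rewrite !qshufflePl IH IH'.
elim/ncpoly_ind: y => [|c y y' IH IH'|v].
- by rewrite qshuffle0r !qshuffle0l qshuffle0r.
- by rewrite qshufflePl !qshufflePr qshufflePl IH IH'.
elim/ncpoly_ind: z => [|c z z' IH IH'|w].
- by rewrite !qshuffle0r.
- by rewrite !qshufflePr IH IH'.
apply/esym/(mul_words_assoc br_axioms qshuffle_linearl qshuffle_linearr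
  qshuffle_letter_rule qshuffle1l qshuffle1r u v w) => // a t.
exact: word_cons.
Qed.

Lemma qshuffle_words_cons a b u v : qw (a :: u) (b :: v) =
  letter k (Some a) * qw u (b :: v) + letter k (Some b) * qw (a :: u) v
  + letter k (br (Some a) (Some b)) * qw u v.
Proof. by []. Qed.

Lemma homogeneous_qshuffle_words u v :
  homogeneous deg (wdeg deg u + wdeg deg v) (qw u v).
Proof.
have [n] := ubnP (size u + size v)%N; elim: n u v => // n IHn u v.
rewrite ltnS => lt_n; case: u => [|a u] in lt_n *; first by rewrite wdeg_nil add0n; apply: homogeneous_word.
case: v => [|b v] in lt_n *; first by rewrite wdeg_nil addn0; apply: homogeneous_word.
rewrite homogeneousE; apply: supportedD; first apply: supportedD.
- apply: homogeneous_letter (IHn u (b :: v) lt_n) => _ [<-].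
  by rewrite !wdeg_cons addnA.
- apply: homogeneous_letter (IHn (a :: u) v _) => [_ [<-]|].
    by rewrite !wdeg_cons addnCA.
  by move: lt_n => /=; lia.
- apply: homogeneous_letter (IHn u v _) => [c br_ab|]; last first.
    by move: lt_n => /=; lia.
  case: (bracket_deg br_axioms a b) => [|[d]]; rewrite br_ab // => -[<-] ->.
  by rewrite !wdeg_cons addnACA.
Qed.

Lemma homogeneous_qshuffle m n x y :
  homogeneous deg m x -> homogeneous deg n y -> homogeneous deg (m + n) (mul x y).
Proof.
move=> xm yn; rewrite homogeneousE.
apply: supported_sum => u /xm <-; apply: supported_sum => v /yn <-.
by apply: supportedZ; apply: homogeneous_qshuffle_words.
Qed.

Lemma qshuffle_graded_algebra : graded_algebra deg mul.
Proof.
split; [exact: qshuffle_linearl|exact: qshuffle_linearr|exact: qshuffleA|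
  exact: qshuffle1l|exact: qshuffle1r| |exact: homogeneous_qshuffle].
by have := @homogeneous_word k A deg [::]; rewrite wdeg_nil.
Qed.

Local Notation E := (qexp_word k br).

(** Groups compositions by their first part [m.+1], whereas the recursion defining them only
    separates first part 1 from larger ones. *)
Lemma big_compositions (R : nmodType) (F : seq nat -> R) n :
  \sum_(c <- compositions n.+1) F c =
  \sum_(m < n.+1) \sum_(c <- compositions (n - m)) F (m.+1 :: c).
Proof.
elim: n F => [|n IHn] F; first by rewrite big_ord1 !big_seq1.
rewrite [compositions _]/(_ ++ _) big_cat big_map big_ord_recl subn0.
congr (_ + _); rewrite big_map big_filter big_mkcond IHn.
by apply: eq_bigr => m _; rewrite subSS.
Qed.

Lemma qexp_word0 : E [::] = word k [::].
Proof.
by rewrite /qexp_word big_seq1 /comp_act !big_nil invr1 scale1r word_nil.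
Qed.

Lemma qexp_word_cons a w : E (a :: w) =
  \sum_(m < (size w).+1) (m.+1`!%:R)^-1 *:
     (letter k (brackets br (a :: take m w)) * E (drop m w)).
Proof.
rewrite /qexp_word -[size _]/((size w).+1) big_compositions; apply: eq_bigr => m _.
rewrite size_drop mulr_sumr scaler_sumr; apply: eq_bigr => c _.
by rewrite big_cons invfM -scalerA malg_scalerAr /comp_act /= big_cons.
Qed.

(** Including the vanishing term [m = 0] makes the sum run over all cuts of the word, the form
    [exp_shuffle] expects. *)
Lemma qexp_wordE a w : E (a :: w) =
  \sum_(m < (size w).+2) (m`!%:R)^-1 *:
     cons_letter (brackets br (take m (a :: w))) (E (drop m (a :: w))).
Proof.
by rewrite qexp_word_cons [RHS]big_ord_recl cons_letterN scaler0 add0r.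
Qed.

Lemma homogeneous_qexp_word w : homogeneous deg (wdeg deg w) (E w).
Proof.
have [n] := ubnP (size w); elim: n w => // n IHn [|a w] lt_n.
  by rewrite qexp_word0; apply: homogeneous_word.
rewrite qexp_word_cons homogeneousE; apply: supported_sum => m _; apply: supportedZ.
apply: homogeneous_letter (IHn (drop m w) _) => [c|].
  move/(brackets_deg br_axioms) ->.
  by rewrite wdeg_cons -addnA -big_cat cat_take_drop wdeg_cons.
by move: lt_n; rewrite size_drop /=; lia.
Qed.

Lemma qexp_word_size w : supported (fun u => (size u <= size w)%N) (E w).
Proof.
have [n] := ubnP (size w); elim: n w => // n IHn [|a w] lt_n.
  by rewrite qexp_word0; apply: (supported_word (P := fun u => (size u <= 0)%N)).
rewrite qexp_word_cons; apply: supported_sum => m _; apply: supportedZ.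
apply: supported_letter (IHn (drop m w) _) => [b u _|].
  by rewrite size_drop /=; lia.
by move: lt_n; rewrite size_drop /=; lia.
Qed.

(** A first block of length 1 leaves [a] times [E w - w], settled by induction; a longer block
    replaces at least two letters by one letter or by 0. *)
Lemma qexp_word_unitriangular w :
  supported (fun u => (size u < size w)%N) (E w - word k w).
Proof.
elim: w => [|a w IHw]; first by rewrite qexp_word0 subrr; apply: supported0.
rewrite qexp_word_cons big_ord_recl take0 drop0 invr1 scale1r word_cons.
rewrite addrAC -mulrBr; apply: supportedD.
  by apply: supported_letter IHw.
apply: supported_sum => m _; apply: supportedZ.
apply: supported_letter (@qexp_word_size _) => b u _.
by rewrite size_drop /= /bump /=; have := ltn_ord m; lia.
Qed.

Lemma qexp_word_shuffle u v :
  (forall n, (0 < n)%N -> n%:R != 0 :> k) ->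
  \sum_(w <- shuffles u v) E w = mul (E u) (E v).
Proof.
move=> natr_neq0.
exact: (exp_shuffle br_axioms cons_letterN qshuffle_linearl qshuffle_linearr
  qshuffle_letter_rule qshuffle1l qshuffle1r natr_neq0 _ _ qexp_word0 qexp_wordE).
Qed.

End QuasiShuffleAlgebra.

(** * The shuffle algebra as the case of the zero bracket *)

Section ShuffleAlgebra.
Variables (k : fieldType) (A : choiceType) (deg : A -> nat).
Local Notation V := (ncpoly k A).
Implicit Types (u v : seq A).

Lemma eq_graded_algebra (mul1 mul2 : V -> V -> V) :
  mul1 =2 mul2 -> graded_algebra deg mul1 -> graded_algebra deg mul2.
Proof.
move=> eq_mul [linl linr mulA one_mul mul_one deg1 degM]; split=> //.
- by move=> y c x x'; rewrite -!eq_mul; apply: linl.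
- by move=> x c y y'; rewrite -!eq_mul; apply: linr.
- by move=> x y z; rewrite -!eq_mul; apply: mulA.
- by move=> x; rewrite -eq_mul; apply: one_mul.
- by move=> x; rewrite -eq_mul; apply: mul_one.
- by move=> m n x y xm yn; rewrite -eq_mul; apply: degM.
Qed.

Lemma bracket_axioms_None : bracket_axioms deg (fun _ _ => None).
Proof. by split=> //; left. Qed.

Lemma shuffle_qshuffle_words u v :
  shuffle_words k u v = qshuffle_words k (fun _ _ => None) u v.
Proof.
elim: u v => [//|a u IHu]; elim=> [//|b v IHv].
rewrite -[LHS]/(letter k (Some a) * shuffle_words k u (b :: v)
                + letter k (Some b) * shuffle_words k (a :: u) v).
by rewrite IHu IHv qshuffle_words_cons mul0r addr0.
Qed.

Lemma shuffle_graded_algebra : graded_algebra deg (@shuffle k A).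
Proof.
apply: eq_graded_algebra (qshuffle_graded_algebra k bracket_axioms_None).
move=> x y; apply: eq_bigr => u _; apply: eq_bigr => v _.
by rewrite shuffle_qshuffle_words.
Qed.

Lemma shuffle_wordsE u v : shuffle_words k u v = \sum_(w <- shuffles u v) word k w.
Proof.
elim: u v => [v|a u IHu]; first by rewrite big_seq1.
elim=> [|b v IHv]; first by rewrite big_seq1.
rewrite -[LHS]/(letter k (Some a) * shuffle_words k u (b :: v)
                + letter k (Some b) * shuffle_words k (a :: u) v).
rewrite shuffles_cons big_cat !big_map IHu IHv !mulr_sumr.
by congr (_ + _); apply: eq_bigr => w _; rewrite word_cons.
Qed.

End ShuffleAlgebra.

Theorem theorem2p5 (R : realType) (k : fieldType)
    (iota : {rmorphism k -> R[i]}) (A : choiceType) (deg : A -> nat)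
    (br : option A -> option A -> option A) :
  locally_finite_graded deg -> bracket_axioms deg br ->
  graded_algebra_iso deg (@shuffle k A) (qshuffle br) (qexp br).
Proof.
move=> _ br_axioms.
have natr_neq0 n : (0 < n)%N -> n%:R != 0 :> k.
  (* The embedding into [R[i]] forces characteristic zero. *)
  by move=> n_gt0; rewrite -(fmorph_eq0 iota) rmorph_nat pnatr_eq0 -lt0n.
have exp_word w : qexp br (word k w) = qexp_word k br w.
  exact: linear_ext_of_word.
have exp_bij : bijective (@qexp k A br).
  apply: unitriangular_bijective => w; rewrite [X in X - _]exp_word.
  exact: qexp_word_unitriangular.
split=> //.
- exact: shuffle_graded_algebra.
- exact: qshuffle_graded_algebra.
- exact: linear_ext_is_linear.
- by rewrite exp_word qexp_word0.
- apply: bilinear_ext_morph => u v.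
  rewrite shuffle_wordsE raddf_sum /= !linear_ext_of_word.
  rewrite -[RHS](qexp_word_shuffle br_axioms) //.
  by apply: eq_bigr => w _; apply: exp_word.
- apply: graded_injective; first exact: bij_inj.
  move=> w; rewrite [X in homogeneous _ _ X]exp_word.
  exact: homogeneous_qexp_word.
Qed.
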